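(* The class $0$-$HNG$ is exactly the class of threshold graphs.
   Context: All graphs are finite, simple, and have at least one vertex; induced subgraphs are taken on nonempty vertex sets. $\chi(G)$ is the chromatic number and $\theta(G)=\chi(\overline{G})$ the clique cover number. A graph $G$ is in $0$-$HNG$ if every induced subgraph $H$ of $G$ (including $G$ itself) satisfies $\chi(H)+\theta(H)\ge |V(H)|+1$ (equivalently, with equality, since $\chi(H)+\theta(H)\le |V(H)|+1$ always holds by Nordhaus and Gaddum). A graph $G$ is threshold if there exist a function $w:V(G)\to\mathbb{R}$ and a real number $t$ such that two distinct vertices $u,v$ are adjacent if and only if $w(u)+w(v)>t$. *)

(* Defs.v *)
From HB Require Import structures.
From mathcomp Require Import all_boot all_order all_algebra.
From mathcomp Require Import reals.

Set Implicit Arguments.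
Unset Strict Implicit.
Unset Printing Implicit Defensive.

Import Order.TTheory GRing.Theory Num.Theory.

Record sgraph := SGraph {
  vertex :> finType;
  adj : rel vertex;
  adj_sym : symmetric adj;
  adj_irr : irreflexive adj;
  vertex_gt0 : 0 < #|vertex| }.

Section Complement.
Variable G : sgraph.

Definition compl_adj : rel G := fun x y => (x != y) && ~~ adj x y.

Lemma compl_adj_sym : symmetric compl_adj.
Proof. by move=> x y; rewrite /compl_adj eq_sym adj_sym. Qed.

Lemma compl_adj_irr : irreflexive compl_adj.
Proof. by move=> x; rewrite /compl_adj eqxx. Qed.

Definition complement : sgraph :=
  SGraph compl_adj_sym compl_adj_irr (vertex_gt0 G).
End Complement.

Section Induced.
Variables (G : sgraph) (A : {set G}) (A_neq0 : A != set0).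

Definition induced_adj : rel {x : G | x \in A} :=
  fun x y => adj (val x) (val y).

Lemma induced_adj_sym : symmetric induced_adj.
Proof. by move=> x y; apply: adj_sym. Qed.

Lemma induced_adj_irr : irreflexive induced_adj.
Proof. by move=> x; apply: adj_irr. Qed.

Lemma induced_gt0 : 0 < #|{: {x : G | x \in A}}|.
Proof. by rewrite card_sig card_gt0. Qed.

Definition induced : sgraph :=
  SGraph induced_adj_sym induced_adj_irr induced_gt0.
End Induced.

Section Chromatic.
Variable G : sgraph.

Definition colorable (k : nat) : bool :=
  [exists f : {ffun G -> 'I_k},
    [forall x, forall y, adj x y ==> (f x != f y)]].

Lemma ex_colorable : exists k, colorable k.
Proof.
exists #|G|; apply/existsP; exists [ffun x => enum_rank x].
apply/forallP => x; apply/forallP => y; apply/implyP => exy.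
rewrite !ffunE (inj_eq enum_rank_inj).
by apply/eqP => xy; rewrite xy adj_irr in exy.
Qed.

Definition chromatic_number : nat := ex_minn ex_colorable.
End Chromatic.

Definition clique_cover_number (G : sgraph) : nat :=
  chromatic_number (complement G).

Definition HNG0 (G : sgraph) : Prop :=
  forall (A : {set G}) (A_neq0 : A != set0),
    let H := induced A_neq0 in
    #|H| + 1 <= chromatic_number H + clique_cover_number H.

Definition threshold (R : realType) (G : sgraph) : Prop :=
  exists (w : G -> R) (t : R),
    forall u v : G, u != v -> adj u v = (t < w u + w v)%R.

(* Main.v *)
Require Import Defs.
From mathcomp Require Import all_boot all_order all_algebra.
From mathcomp Require Import reals.
From mathcomp Require Import lra.

Import Order.TTheory GRing.Theory Num.Theory.

(** If a graph has weights [w] and threshold [t], its vertices split into the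
    clique [w > t/2] and the independent set [w <= t/2], and some vertex can be
    added to the other part; a clique and an independent set of total size
    [#|G| + 1] bound [chi] and [theta] from below. Conversely, an alternating
    4-cycle (edges [ab], [cd], non-edges [ac], [bd]) induces a graph on four
    vertices with [chi = theta = 2], so graphs in 0-HNG have none. Without
    alternating 4-cycles every induced subgraph has a dominating or an isolated
    vertex, and peeling these off one by one yields weights. *)

Lemma chromatic_number_le (G : sgraph) (T : finType) (f : G -> T) :
  (forall x y, adj x y -> f x != f y) -> chromatic_number G <= #|T|.
Proof.
move=> fP; rewrite /chromatic_number; case: ex_minnP => m _; apply.
apply/existsP; exists [ffun x => enum_rank (f x)].
apply/forallP => x; apply/forallP => y; apply/implyP => xy.
by rewrite !ffunE (inj_eq enum_rank_inj) fP.
Qed.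

Lemma clique_le_chromatic (G : sgraph) (K : {set G}) :
  {in K &, forall x y, x != y -> adj x y} -> #|K| <= chromatic_number G.
Proof.
move=> KP; rewrite /chromatic_number; case: ex_minnP => m /existsP[f fP] _.
have f_inj : {in K &, injective f}.
  move=> x y xK yK fxy; apply/eqP/negPn/negP => xy.
  move/forallP: fP => /(_ x)/forallP/(_ y)/implyP/(_ (KP _ _ xK yK xy)).
  by rewrite fxy eqxx.
by rewrite -(card_in_imset f_inj) -[leqRHS]card_ord max_card.
Qed.

Lemma stable_le_clique_cover (G : sgraph) (S : {set G}) :
  {in S &, forall x y, ~~ adj x y} -> #|S| <= clique_cover_number G.
Proof.
move=> SP; apply: (@clique_le_chromatic (complement G)) => x y xS yS xy /=.
by rewrite /compl_adj xy SP.
Qed.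

(** Heredity reduces the bound on all induced subgraphs to the bound on a single threshold graph. *)
Lemma threshold_induced (R : realType) (G : sgraph) (A : {set G})
  (A_neq0 : A != set0) : threshold R G -> threshold R (induced A_neq0).
Proof.
move=> [w [t wP]]; exists (fun x => w (val x)), t => u v uv /=.
by rewrite /induced_adj wP.
Qed.

Lemma threshold_chromatic_sum (R : realType) (G : sgraph) :
  threshold R G -> #|G| + 1 <= chromatic_number G + clique_cover_number G.
Proof.
move=> [w [t wP]].
pose K := [set x | (t < w x + w x)%R]; pose S := ~: K.
have KP : {in K &, forall x y, x != y -> adj x y}.
  by move=> x y; rewrite !inE => xK yK xy; rewrite wP //; lra.
have SP : {in S &, forall x y, ~~ adj x y}.
  move=> x y; rewrite !inE -!leNgt => xS yS.
  have [->|xy] := eqVneq x y; first by rewrite adj_irr.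
  by rewrite wP // -leNgt; lra.
(* A vertex of [K] without neighbours in [S] can join [S]; if there is none, some vertex of [S] can
   join [K]. *)
have [/exists_inP[k kK /forall_inP kP]|/exists_inPn noK] :=
  boolP [exists k in K, [forall s in S, ~~ adj k s]].
  have kS : k \notin S by rewrite inE kK.
  have -> : #|G| + 1 = #|K| + #|k |: S| by rewrite cardsU1 kS addnCA addnC cardsC.
  apply: leq_add; first exact: clique_le_chromatic.
  apply: stable_le_clique_cover => x y /setU1P[->|xS] /setU1P[->|yS].
  - by rewrite adj_irr.
  - exact: kP.
  - by rewrite adj_sym kP.
  - exact: SP.
have nbrK k : k \in K -> exists2 s, s \in S & adj k s.
  by move/noK/forall_inPn => [s sS /negPn]; exists s.
have [s0 s0S] : exists s, s \in S.
  have /card_gt0P[x _] := vertex_gt0 G.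
  case: (boolP (x \in K)) => [/nbrK[s sS _]|xK]; first by exists s.
  by exists x; rewrite inE.
(* The heaviest [s] in [S] sees all of [K]: each [k] in [K] has a neighbour [r] in [S], and
   [w r <= w s]. *)
case: (@arg_maxP _ _ _ s0 (mem S) w s0S) => s sS smax.
have sK : s \notin K by rewrite -in_setC.
have sP k : k \in K -> adj k s.
  move=> kK; have [r rS kr] := nbrK _ kK.
  have neq z : z \in S -> k != z.
    by move=> zS; apply: contraTneq kK => ->; rewrite -in_setC.
  have rs : (w r <= w s)%R := smax _ rS.
  by move: kr; rewrite !wP ?neq //; lra.
have -> : #|G| + 1 = #|s |: K| + #|S| by rewrite cardsU1 sK -addnA cardsC addnC.
apply: leq_add; last exact: stable_le_clique_cover.
apply: clique_le_chromatic => x y /setU1P[->|xK] /setU1P[->|yK] xy.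
- by rewrite eqxx in xy.
- by rewrite adj_sym sP.
- exact: sP.
- exact: KP.
Qed.

(** The pairs [ad] and [bc] are left free, so this forbids induced 2K2, P4 and C4 at once. *)
Definition no_alternating_4cycle (G : sgraph) : Prop :=
  forall a b c d : G, adj a b -> adj c d -> a != c -> b != d ->
    adj a c || adj b d.

Lemma HNG0_no_alternating_4cycle (G : sgraph) :
  HNG0 G -> no_alternating_4cycle G.
Proof.
move=> GP a b c d ab cd ac bd; apply: contraT; rewrite negb_or => /andP[nac nbd].
have neq_adj (x y : G) : adj x y -> x != y.
  by apply: contraTneq => ->; rewrite adj_irr.
have ad : a != d by apply: contraNneq nbd => <-; rewrite adj_sym.
have bc : b != c by apply: contraNneq nac => <-.
pose A := [set a; b; c; d].
have A_neq0 : A != set0 by apply/set0Pn; exists a; rewrite !inE eqxx.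
have A4 : #|induced A_neq0| = 4.
  rewrite /= card_sig -[LHS]cardsE.
  have -> : [set x in [in A]] = [set x in [:: a; b; c; d]].
    by apply/setP => x; rewrite !inE -!orbA.
  rewrite cardsE; apply/card_uniqP => /=.
  by rewrite !inE !negb_or ac ad bc bd !neq_adj.
have A_case x : x \in A -> [\/ x = a, x = b, x = c | x = d].
  by rewrite !inE -!orbA => /or4P[]/eqP; constructor.
(* The non-edges [ac] and [bd] are the two colour classes. *)
have chi2 : chromatic_number (induced A_neq0) <= #|{: bool}|.
  pose f (x : G) := x \in [:: a; c].
  have fa : f a by rewrite /f !inE eqxx.
  have fb : f b = false by rewrite /f !inE (negPf bc) eq_sym (negPf (neq_adj _ _ ab)).
  have fc : f c by rewrite /f !inE eqxx orbT.
  have fd : f d = false.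
    by rewrite /f !inE ![d == _]eq_sym (negPf ad) (negPf (neq_adj _ _ cd)).
  apply: (@chromatic_number_le (induced A_neq0) bool (fun x => f (val x))).
  move=> [x xA] [y yA] /=; apply: contraTneq; rewrite /induced_adj /=.
  by case: (A_case x xA) (A_case y yA) => -> [] ->;
    rewrite ?fa ?fb ?fc ?fd ?adj_irr // adj_sym.
(* The edges [ab] and [cd] are the two covering cliques. *)
have theta2 : clique_cover_number (induced A_neq0) <= #|{: bool}|.
  pose f (x : G) := x \in [:: a; b].
  have fa : f a by rewrite /f !inE eqxx.
  have fb : f b by rewrite /f !inE eqxx orbT.
  have fc : f c = false by rewrite /f !inE ![c == _]eq_sym (negPf ac) (negPf bc).
  have fd : f d = false by rewrite /f !inE ![d == _]eq_sym (negPf ad) (negPf bd).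
  apply: (@chromatic_number_le (complement (induced A_neq0)) bool
            (fun x => f (val x))).
  move=> [x xA] [y yA] /=; apply: contraTneq.
  rewrite /compl_adj negb_and !negbK -val_eqE /= /induced_adj /=.
  by case: (A_case x xA) (A_case y yA) => -> [] ->;
    rewrite ?fa ?fb ?fc ?fd ?eqxx ?ab ?cd ?orbT // adj_sym ?ab ?cd orbT.
have := leq_trans (GP A A_neq0) (leq_add chi2 theta2).
by rewrite A4 card_bool.
Qed.

(** Take [v] of maximal degree within [A]. If [v] misses some [u], then [u] is isolated: a neighbour
    [x] of [u] would, by maximality, miss some neighbour [y] of [v], and the edges [ux], [vy] with
    the non-edges [uv], [xy] would alternate. *)
Lemma dominating_or_isolated (G : sgraph) (A : {set G}) :
  no_alternating_4cycle G -> A != set0 ->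
  exists2 v, v \in A & exists b, {in A :\ v, forall u, adj u v = b}.
Proof.
move=> GP /set0Pn[x0 x0A].
pose N x := [set y in A | adj x y].
case: (@arg_maxnP _ x0 (mem A) (fun x => #|N x|) x0A) => v /= vA vmax.
have [/forall_inP vdom|/forall_inPn[u]] := boolP [forall u in A :\ v, adj u v].
  by exists v => //; exists true.
rewrite !inE => /andP[uv uA] nuv.
exists u => //; exists false => x; rewrite !inE => /andP[xu xA].
apply/negP => xadj.
have xv : x != v by apply: contraNneq nuv => <-; rewrite adj_sym.
suff [y [yx vy nxy]] : exists y, [/\ y != x, adj v y & ~~ adj x y].
  have := GP u x v y; rewrite adj_sym xadj vy uv eq_sym yx.
  by rewrite (negPf nuv) (negPf nxy) => /(_ isT isT isT isT).
have uNx : u \in N x by rewrite inE uA.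
have sub_card (B C : {set G}) : #|C| <= #|B| -> u \in C -> u \notin B ->
    exists2 y, y \in B & y \notin C.
  move=> CB uC uB; apply/subsetPn; apply: contraNN uB => sBC.
  by have /eqP-> : B == C by rewrite eqEcard sBC.
have [vx|nvx] := boolP (adj v x).
  (* closed neighbourhoods exclude [y = x] here, open ones otherwise *)
  have [|||y] := sub_card (v |: N v) (x |: N x).
  - by rewrite !cardsU1 !inE !adj_irr !andbF leq_add2l; apply: vmax.
  - by rewrite inE uNx orbT.
  - by rewrite !inE negb_or uv uA adj_sym.
  rewrite !inE => /orP[/eqP->|/andP[yA vy]].
    by rewrite [v \in A]vA adj_sym vx orbT.
  by rewrite negb_or yA => /andP[yx nxy]; exists y.
have [|||y] := sub_card (N v) (N x).
- exact: vmax.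
- by [].
- by rewrite inE uA adj_sym.
rewrite !inE => /andP[yA vy]; rewrite yA => nxy; exists y; split=> //.
by apply: contraNneq nvx => <-.
Qed.

(** The bound on [w] is the invariant that lets the induction on the size of [A] choose a weight for
    the next vertex; the threshold stays [0]. *)
Lemma no_alternating_4cycle_weights (R : realType) (G : sgraph)
  (A : {set G}) :
  no_alternating_4cycle G -> exists w : G -> R,
    {in A, forall u, `|w u| <= #|A|%:R}%R /\
    {in A &, forall u v, u != v -> adj u v = (0 < w u + w v)%R}.
Proof.
move=> GP; have [n] := ubnP #|A|; elim: n A => // n IHn A.
have [->|A_neq0] := eqVneq A set0.
  by exists (fun=> 0%R); split=> [u|u v]; rewrite inE.
have [v vA [b vb]] := dominating_or_isolated G A GP A_neq0.
rewrite (cardsD1 v) vA ltnS => /IHn[w [wle wadj]].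
(* [M] exceeds every earlier weight in absolute value, so the sign of [w' v] alone decides adjacency
   to [v]: [M] if [v] dominates, [- M] if it is isolated. *)
pose M : R := (1 + #|A :\ v|)%:R%R.
have M_gt : (M = 1 + #|A :\ v|%:R)%R by rewrite /M natrD.
pose w' x : R := if x == v then (if b then M else - M)%R else w x.
have wv u : u \in A -> u != v -> adj u v = (0 < w u + w' v)%R.
  move=> uA uv; have uAv : u \in A :\ v by rewrite !inE uv.
  have := wle _ uAv; rewrite (vb _ uAv) ler_norml /w' eqxx => /andP[? ?].
  by case: b {vb w' uAv}; apply/esym; [|apply/negbTE; rewrite -leNgt]; lra.
have w'E u : u != v -> w' u = w u by rewrite /w' => /negPf->.
exists w'; split=> [u uA|u u' uA u'A uu'].
  have [->|uv] := eqVneq u v.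
    by rewrite /w' eqxx; case: b {vb w' wv w'E} => //; rewrite ?normrN ger0_norm ?ler0n.
  rewrite w'E // (le_trans (wle _ _)) ?inE ?uv //.
  by rewrite ler_nat leq_addl.
have [u_v|uv] := eqVneq u v.
  by rewrite u_v adj_sym addrC (w'E u') ?wv // -u_v eq_sym.
have [->|u'v] := eqVneq u' v; first by rewrite (w'E u) ?wv.
by rewrite !w'E // wadj // !inE ?uv ?u'v.
Qed.

Theorem proposition1p3 (R : realType) (G : sgraph) : HNG0 G <-> threshold R G.
Proof.
split=> [/HNG0_no_alternating_4cycle GP | GP A A_neq0].
  have [w [_ wP]] := no_alternating_4cycle_weights R G [set: G] GP.
  by exists w, 0%R => u v; apply: wP.
exact/(threshold_chromatic_sum R)/threshold_induced.
Qed.
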